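(* Every homological Dehn function is $\simeq$ equivalent to a superadditive function: for every group $H$ of type $FP_2$ there is a superadditive function $h\colon\mathbb{N}\to[0,\infty)$ with $\mathrm{FA}_H\simeq h$.
   Context: A function $f\colon\mathbb{N}\to[0,\infty)$ is superadditive if $f(m+n)\ge f(m)+f(n)$ for all $m,n\ge0$. Homology is with $\mathbb{Z}$ coefficients. A group $H$ is of type $FP_2$ if there is an exact sequence $P_2\to P_1\to P_0\to\mathbb{Z}\to0$ of $\mathbb{Z}H$-modules with all $P_i$ finitely generated projective. Equivalence of functions: for $f,g\colon[0,\infty)\to[0,\infty)$ write $f\preceq g$ if there are constants $A,B>0$ and $C,D,E\ge 0$ with $f(n)\le A\,g(Bn+C)+Dn+E$ for all $n\ge0$; $f\simeq g$ means $f\preceq g$ and $g\preceq f$. Functions on $\mathbb{N}$ are extended to be constant on each $[n,n+1)$. A combinatorial complex is a CW complex in which each attaching map sends open cells of some combinatorial structure on the sphere homeomorphically onto open cells. If $X$ is a combinatorial complex with $H_1(X)=0$ and $\gamma$ is a cellular 1-cycle, then $\mathrm{HArea}_X(\gamma)=\min\{\sum|a_i| : \gamma=\partial\sum a_i\sigma_i\}$, where $a_i\in\mathbb{Z}$ and the $\sigma_i$ are 2-cells; $|\gamma|$ is the $\ell^1$-norm in $C_1(X)$; and $\mathrm{FA}_X(n)=\sup\{\mathrm{HArea}_X(\gamma) : \gamma \text{ a 1-cycle},\ |\gamma|\le n\}$. Homological Dehn function: let $H$ be a group generated by a finite set $\mathcal{A}$, and let $R_0$ be a finite set of words in $F(\mathcal{A})$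 that are trivial in $H$. Let $X(\mathcal{A},R_0)$ be obtained from the Cayley graph $\Gamma(H,\mathcal{A})$ by attaching, for each $r\in R_0$ and each vertex $v$, a disk along the closed path starting at $v$ labeled $r$. The pair is a homological finite presentation of $H$ if $H_1(X(\mathcal{A},R_0))=0$. Such a presentation exists iff $H$ is of type $FP_2$, and then $\mathrm{FA}_H:=\mathrm{FA}_{X(\mathcal{A},R_0)}$, well defined up to $\simeq$. *)

(* Defs.v *)
From HB Require Import structures.
From mathcomp Require Import all_boot all_order all_algebra finmap.
From mathcomp Require Import all_classical all_reals ereal.
From mathcomp Require Import -(notations) monalg.

Set Implicit Arguments.
Unset Strict Implicit.
Unset Printing Implicit Defensive.

Import Order.TTheory GRing.Theory Num.Theory.

Local Open Scope ring_scope.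

(* The notations of monalg clash with those of the analysis libraries. *)
Notation "{ 'malg' G [ K ] }" := (@malg K G)
  (at level 0, K, G at level 2, format "{ 'malg'  G [ K ] }") : type_scope.
Notation "g @_ k" := (mcoeff k g)
  (at level 3, k at level 2, left associativity, format "g @_ k").
Notation "<< k >>" := (mkmalgU k 1) (at level 0, format "<< k >>") : ring_scope.

(* The free abelian group on K is {malg int[K]}; [<< k >>] is the basis element
   of k, and [zlin f] is the additive extension of f : K -> V.                *)

Section FreeAbelian.
Variables (K : choiceType) (V : zmodType).
Implicit Types (f g : K -> V) (c : {malg int[K]}).

Definition zlin f c : V := \sum_(k <- msupp c) f k *~ c@_k.

Lemma zlinEw f c (D : {fset K}) :
  (msupp c `<=` D)%fset -> zlin f c = \sum_(k <- D) f k *~ c@_k.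
Proof.
move=> sD; rewrite /zlin; apply: big_fset_incl => // k _ kc.
by rewrite (mcoeff_outdom kc) mulr0z.
Qed.

Lemma zlinD f : {morph zlin f : c1 c2 / c1 + c2}.
Proof.
move=> c1 c2; set D := (msupp c1 `|` msupp c2)%fset.
rewrite (@zlinEw _ _ D) ?msuppD_le // (@zlinEw _ c1 D) ?fsubsetUl //.
rewrite (@zlinEw _ c2 D) ?fsubsetUr // -big_split /=.
by apply: eq_bigr => k _; rewrite mcoeffD mulrzDr.
Qed.

Lemma zlin0 f : zlin f 0 = 0.
Proof. by rewrite /zlin msupp0 big_seq_fset0. Qed.

Lemma zlinU f k : zlin f << k >> = f k.
Proof.
by rewrite /zlin msuppU oner_eq0 big_seq_fset1 mcoeffUU mulr1z.
Qed.

Lemma zlinDf f g c : zlin (fun k => f k + g k) c = zlin f c + zlin g c.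
Proof. by rewrite /zlin -big_split; apply: eq_bigr => k _; rewrite mulrzDl. Qed.

Lemma zlin_ext f g c : f =1 g -> zlin f c = zlin g c.
Proof. by move=> e; apply: eq_bigr => k _; rewrite e. Qed.

End FreeAbelian.

Lemma zlin_comp (K : choiceType) (V W : zmodType) (phi : V -> W) (f : K -> V) c :
  phi 0 = 0 -> {morph phi : x y / x + y} ->
  phi (zlin f c) = zlin (phi \o f) c.
Proof.
move=> p0 pD.
have pN x : phi (- x) = - phi x by apply/eqP; rewrite -addr_eq0 -pD addNr p0.
have pMn x n : phi (x *+ n) = phi x *+ n.
  by elim: n => [|n IH]; rewrite ?mulr0n // !mulrS pD IH.
rewrite /zlin; elim: (enum_fset _) => [|k s IH]; first by rewrite !big_nil.
rewrite !big_cons pD IH; congr (_ + _) => /=.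
by case: (c@_k) => n; rewrite ?NegzE ?mulrNz ?pN -?pmulrn pMn.
Qed.

Lemma zlin_id (K : choiceType) (c : {malg int[K]}) :
  zlin (fun k => << k >>) c = c.
Proof.
rewrite [RHS]monalgE; apply: eq_bigr => k _.
apply/malgP => k'; rewrite mcoeffU.
have -> : (<< k >> *~ c@_k)@_k' = (<< k >>@_k' : int) *~ c@_k.
  exact: (raddfMz (mcoeff k')).
by rewrite mcoeffU; case: (k == k'); rewrite ?mulr0n ?mulr1n ?mul0rz ?intz.
Qed.

Definition norm1 (K : choiceType) (c : {malg int[K]}) : nat :=
  (\sum_(k <- msupp c) `|c@_k|)%N.

Definition group_ring (H : groupType) : Type := {malg int[H]}.

Section GroupRing.
Variable H : groupType.

HB.instance Definition _ := GRing.Zmodule.on (group_ring H).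

Implicit Types x y z : group_ring H.

Definition gr_one : group_ring H := << (1 : H)%g >>.

Definition gr_mul x y : group_ring H :=
  zlin (fun g : H => zlin (fun h : H => << (g * h)%g >>) y) x.

Definition augmentation x : int := zlin (fun _ => 1) x.

Lemma gr_mulDl : left_distributive gr_mul +%R.
Proof. by move=> x y z; apply: zlinD. Qed.

Lemma gr_mulDr : right_distributive gr_mul +%R.
Proof.
move=> x y z; rewrite /gr_mul -zlinDf; apply: zlin_ext => g; exact: zlinD.
Qed.

Lemma gr_mul0l y : gr_mul 0 y = 0.
Proof. exact: zlin0. Qed.

Lemma gr_mul0r x : gr_mul x 0 = 0.
Proof. by apply: (addrI (gr_mul x 0)); rewrite -gr_mulDr !addr0. Qed.

Lemma gr_mulUl (g : H) y : gr_mul << g >> y = zlin (fun h : H => << (g * h)%g >>) y.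
Proof. exact: zlinU. Qed.

Lemma gr_mulUU (g h : H) : gr_mul << g >> << h >> = << (g * h)%g >>.
Proof. by rewrite gr_mulUl zlinU. Qed.

Lemma gr_ext (V : zmodType) (p q : group_ring H -> V) :
  p 0 = 0 -> q 0 = 0 -> {morph p : x y / x + y} -> {morph q : x y / x + y} ->
  (forall g : H, p << g >> = q << g >>) -> p =1 q.
Proof.
move=> p0 q0 pD qD e x.
by rewrite -[x](@zlin_id H) !zlin_comp //; apply: zlin_ext => g; apply: e.
Qed.

Lemma gr_mulA : associative gr_mul.
Proof.
move=> x y z.
apply: (@gr_ext _ (gr_mul^~ (gr_mul y z)) (fun x => gr_mul (gr_mul x y) z))
  => [||x1 x2|x1 x2|g].
- exact: gr_mul0l.
- by rewrite !gr_mul0l.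
- exact: gr_mulDl.
- by rewrite !gr_mulDl.
apply: (@gr_ext _ (fun y => gr_mul << g >> (gr_mul y z))
                  (fun y => gr_mul (gr_mul << g >> y) z))
  => [||y1 y2|y1 y2|h].
- by rewrite gr_mul0l gr_mul0r.
- by rewrite gr_mul0r gr_mul0l.
- by rewrite gr_mulDl gr_mulDr.
- by rewrite gr_mulDr gr_mulDl.
apply: (@gr_ext _ (fun z => gr_mul << g >> (gr_mul << h >> z))
                  (fun z => gr_mul (gr_mul << g >> << h >>) z))
  => [||z1 z2|z1 z2|k].
- by rewrite !gr_mul0r.
- exact: gr_mul0r.
- by rewrite !gr_mulDr.
- exact: gr_mulDr.
by rewrite !gr_mulUU mulgA.
Qed.

Lemma gr_mul1l : left_id gr_one gr_mul.
Proof.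
move=> x; rewrite gr_mulUl -[RHS](@zlin_id H).
by apply: zlin_ext => h; rewrite mul1g.
Qed.

Lemma gr_mul1r : right_id gr_one gr_mul.
Proof.
move=> x; rewrite -[RHS](@zlin_id H).
by apply: zlin_ext => h; rewrite zlinU mulg1.
Qed.

Lemma gr_one_neq0 : gr_one != 0.
Proof. by rewrite monalgU_eq0 oner_eq0. Qed.

HB.instance Definition _ := GRing.Zmodule_isNzRing.Build (group_ring H)
  gr_mulA gr_mul1l gr_mul1r gr_mulDl gr_mulDr gr_one_neq0.

Lemma augmentationD : {morph augmentation : x y / x + y}.
Proof. exact: zlinD. Qed.

Lemma augmentation1 : augmentation 1 = 1.
Proof. exact: zlinU. Qed.

Lemma augmentationM : {morph augmentation : x y / x * y}.
Proof.
move=> x y.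
have a0 : augmentation 0 = 0 by apply: zlin0.
apply: (@gr_ext _ (fun x => augmentation (x * y))
                  (fun x => augmentation x * augmentation y))
  => [||x1 x2|x1 x2|g]; rewrite ?a0 ?mul0r ?augmentationD ?mulrDl
    ?augmentationD //.
apply: (@gr_ext _ (fun y => augmentation ((<< g >> : group_ring H) * y))
                  (fun y => augmentation << g >> * augmentation y))
  => [||y1 y2|y1 y2|h]; rewrite ?a0 ?mulr0 ?augmentationD ?mulrDr
    ?augmentationD //.
by rewrite [X in augmentation X]gr_mulUU /augmentation !zlinU mulr1.
Qed.

End GroupRing.

Definition trivial_module (H : groupType) : Type := int.

Section TrivialModule.
Variable H : groupType.

HB.instance Definition _ := GRing.Zmodule.on (trivial_module H).

Definition triv_scale (a : group_ring H) (n : trivial_module H) :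
  trivial_module H := augmentation a * (n : int).

Fact triv_scaleA a b v : triv_scale a (triv_scale b v) = triv_scale (a * b) v.
Proof. by rewrite /triv_scale augmentationM mulrA. Qed.

Fact triv_scale1 : left_id 1 triv_scale.
Proof. by move=> v; rewrite /triv_scale augmentation1 mul1r. Qed.

Fact triv_scaleDr : right_distributive triv_scale +%R.
Proof. by move=> a u v; apply: mulrDr. Qed.

Fact triv_scaleDl v : {morph triv_scale^~ v : a b / a + b}.
Proof. by move=> a b; rewrite /triv_scale augmentationD mulrDl. Qed.

HB.instance Definition _ := GRing.Zmodule_isLmodule.Build (group_ring H)
  (trivial_module H) triv_scaleA triv_scale1 triv_scaleDr triv_scaleDl.

End TrivialModule.

Definition finitely_generated (S : nzRingType) (M : lmodType S) : Prop :=
  exists (n : nat) (v : 'I_n -> M),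
    forall x : M, exists a : 'I_n -> S, x = \sum_i a i *: v i.

Definition projective (S : nzRingType) (P : lmodType S) : Prop :=
  forall (M N : lmodType S) (p : {linear M -> N}) (f : {linear P -> N}),
    (forall y, exists x, p x = y) ->
    exists g : {linear P -> M}, forall x, p (g x) = f x.

Definition exact_at (S : nzRingType) (M N L : lmodType S)
    (f : {linear M -> N}) (g : {linear N -> L}) : Prop :=
  forall y : N, g y = 0 <-> exists x, f x = y.

Definition type_FP2 (H : groupType) : Prop :=
  exists (P2 P1 P0 : lmodType (group_ring H))
         (d2 : {linear P2 -> P1}) (d1 : {linear P1 -> P0})
         (eps : {linear P0 -> trivial_module H}),
    [/\ finitely_generated P2 /\ projective P2,
        finitely_generated P1 /\ projective P1,
        finitely_generated P0 /\ projective P0 &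
        [/\ exact_at d2 d1, exact_at d1 eps & forall n, exists x, eps x = n]].

(* Combinatorial 2-complexes.  A pair (e, true) is the edge e traversed from
   source to target, (e, false) is e traversed backwards.  A 2-cell is attached
   along a closed edge path; its base point is recorded so that the path may be
   constant.                                                                  *)

Section EdgePaths.
Variables (V E : choiceType) (src tgt : E -> V).

Definition step_src (s : E * bool) : V := if s.2 then src s.1 else tgt s.1.
Definition step_tgt (s : E * bool) : V := if s.2 then tgt s.1 else src s.1.

Fixpoint edge_path (u : V) (p : seq (E * bool)) (v : V) : Prop :=
  if p is s :: p' then step_src s = u /\ edge_path (step_tgt s) p' v
  else u = v.

End EdgePaths.

Record complex2 := Complex2 {
  vert : choiceType;
  edge : choiceType;
  face : choiceType;
  src : edge -> vert;
  tgt : edge -> vert;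
  base : face -> vert;
  attach : face -> seq (edge * bool);
  attach_closed : forall s, edge_path src tgt (base s) (attach s) (base s)
}.

Section CellularChains.
Variable X : complex2.

Definition boundary1 : {malg int[edge X]} -> {malg int[vert X]} :=
  zlin (fun e => << tgt e >> - << src e >>).

Definition boundary2 : {malg int[face X]} -> {malg int[edge X]} :=
  zlin (fun s => \sum_(t <- attach s) (if t.2 then << t.1 >> else - << t.1 >>)).

Definition is_cycle1 (c : {malg int[edge X]}) : Prop := boundary1 c = 0.

Definition H1_trivial : Prop :=
  forall c, is_cycle1 c -> exists b, boundary2 b = c.

End CellularChains.

Section FillingArea.
Variables (R : realType) (X : complex2).
Local Open Scope classical_set_scope.
Local Open Scope ereal_scope.

(* The infimum is over natural numbers, so it is a minimum as soon as c is a
   boundary; it is +oo otherwise.                                             *)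
Definition HArea (c : {malg int[edge X]}) : \bar R :=
  ereal_inf [set ((norm1 b)%:R)%:E | b in [set b | boundary2 b = c]].

(* A priori +oo is a possible value; finiteness is not built in. *)
Definition FA (n : nat) : \bar R :=
  ereal_sup [set HArea c | c in [set c | is_cycle1 c /\ (norm1 c <= n)%N]].

End FillingArea.

(* Words in A^{+-1}: (a, true) is the letter a, (a, false) its inverse. *)

Section CayleyComplex.
Variable H : groupType.

Section Words.
Variable A : {fset H}.

Definition word : Type := seq (A * bool).
HB.instance Definition _ := Choice.on word.

Definition letter (s : A * bool) : H :=
  if s.2 then val s.1 else ((val s.1)^-1)%g.

Definition word_eval (w : word) : H := foldr (fun s g => (letter s * g)%g) 1%g w.

Definition generates : Prop := forall g : H, exists w : word, word_eval w = g.

Definition cayley_src (e : H * A) : H := e.1.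
Definition cayley_tgt (e : H * A) : H := (e.1 * val e.2)%g.

Fixpoint cayley_path (v : H) (w : word) : seq ((H * A) * bool) :=
  if w is s :: w' then
    ((if s.2 then v else v * (val s.1)^-1, s.1), s.2)%g
      :: cayley_path (v * letter s)%g w'
  else [::].

Lemma cayley_pathP v w :
  edge_path cayley_src cayley_tgt v (cayley_path v w) (v * word_eval w)%g.
Proof.
elim: w v => [|[a [] ] w IH] v /=; first by rewrite mulg1.
- by split=> //; rewrite mulgA; apply: IH.
- split; first by rewrite /step_src /cayley_tgt /= mulgVK.
  by rewrite mulgA; apply: IH.
Qed.

End Words.

Record presentation := Presentation {
  gens : {fset H};
  rels : {fset word gens};
  rels_trivial : forall r, r \in rels -> word_eval r = 1%g
}.

Variable P : presentation.

Definition cayley_attach (s : H * rels P) : seq ((H * gens P) * bool) :=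
  cayley_path s.1 (val s.2).

Fact cayley_attach_closed s :
  edge_path (@cayley_src _) (@cayley_tgt _) s.1 (cayley_attach s) s.1.
Proof.
have := cayley_pathP s.1 (val s.2).
by rewrite (rels_trivial (valP s.2)) mulg1.
Qed.

Definition cayley_complex : complex2 := Complex2 cayley_attach_closed.

Definition homological_finite_presentation : Prop :=
  generates (gens P) /\ H1_trivial cayley_complex.

End CayleyComplex.

Section Growth.
Variable R : realType.

Definition superadditive (f : nat -> R) : Prop :=
  forall m n : nat, f m + f n <= f (m + n)%N.

(* Functions on [0, oo) are represented by functions on R whose values at
   negative arguments are irrelevant. *)
Definition step_extend (f : nat -> \bar R) : R -> \bar R :=
  fun x => f (Num.truncn x).

Definition fun_preceq (f g : R -> \bar R) : Prop :=
  exists A B C D E : R,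
    [/\ 0 < A, 0 < B, 0 <= C, 0 <= D & 0 <= E] /\
    forall x : R, 0 <= x ->
      (f x <= A%:E * g (B * x + C)%R + (D * x + E)%:E)%E.

Definition fun_equiv (f g : R -> \bar R) : Prop :=
  fun_preceq f g /\ fun_preceq g f.

End Growth.

(* Main.v *)
Require Import Defs.
From HB Require Import structures.
From mathcomp Require Import all_boot all_order all_algebra finmap.
From mathcomp Require Import all_classical all_reals ereal.
From mathcomp Require Import -(notations) monalg.
From mathcomp Require Import zify.

Set Implicit Arguments.
Unset Strict Implicit.
Unset Printing Implicit Defensive.

Import Order.TTheory GRing.Theory Num.Theory.

Local Open Scope ring_scope.

(** For an infinite group H the filling function itself is superadditive, and
for a finite group it is bounded by a linear function, hence equivalent to 0.

Let H be infinite, and let c1 and c2 be cycles realizing FA(m) = k and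
FA(n) = l.  Consider c1 + g.c2 with g so far away that every chain of faces
from c1 to g.c2 is longer than k + l.  A filling b of c1 + g.c2 of area less
than k + l misses one of k + l successive layers around c1, so b is the sum of
an inner and an outer part whose boundaries have no common edge.  The inner
part fills c1 and the outer part fills g.c2, so b has area at least k + l after
all ([filling_splits], [FA_superadditive]).  In a finite group there is nowhere
to go, but then the cycles are combinations of finitely many loops
([FA_finite_group]).

The rest makes this meaningful.

The values of FA are finite ([cayley_cycle_fillable]): a cycle of norm at most
n is a sum of at most n closed paths of length at most n
([cycle_decomposition]), and up to translation there are finitely many of these.

The equivalence class of FA does not depend on the presentation
([FA_comparison]): substituting words for generators gives equivariant maps
phi and psi between the 1-chains of the two Cayley graphs that commute with the
boundary.  A cycle c is the sum of
phi (psi c) and c - phi (psi c).  The first is filled by transporting a filling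
of psi c face by face; the second is a combination of the cycles
e - phi (psi e), for e an edge of c, and these are boundedly expensive.

A group of type FP_2 has a homological finite presentation
([FP2_presentation]).  Comparing the given resolution with the free module
Z[H] (as in the lemma of Schanuel) shows that the augmentation ideal is finitely
generated, and the supports of its generators generate H ([FP1_generates]).
Comparing it with the chain complex of the Cayley graph shows that the module of
1-cycles is finitely generated ([cycle_module_fg]); as relators one takes all
trivial words that are no longer than the norms of its generators. *)

(** * Integral chains and the l1-norm *)

Section ZlinAdditive.
Variables (K : choiceType) (V : zmodType) (f : K -> V).
Fact zlin_nmod_morphism : nmod_morphism (zlin f).
Proof. by split; [apply: zlin0 | apply: zlinD]. Qed.
HB.instance Definition _ :=
  GRing.isNmodMorphism.Build {malg int[K]} V (zlin f) zlin_nmod_morphism.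
End ZlinAdditive.

(** Identities between additive maps on chains are checked with this on basis
elements only. *)
Lemma malg_ind (K : choiceType) (Q : {malg int[K]} -> Prop) :
  (forall k, Q << k >>) -> Q 0 -> (forall a b, Q a -> Q b -> Q (a - b)) ->
  forall c, Q c.
Proof.
move=> QU Q0 QB c.
have QN a : Q a -> Q (- a) by move=> Qa; rewrite -[- a]add0r; apply: QB.
have QD a b : Q a -> Q b -> Q (a + b).
  by move=> Qa Qb; rewrite -[b]opprK; apply: QB => //; apply: QN.
have QM a n : Q a -> Q (a *+ n).
  by move=> Qa; elim: n => [|n IH]; rewrite ?mulr0n // mulrS; apply: QD.
rewrite -[c]zlin_id /zlin; elim: (enum_fset _) => [|k s IH].
  by rewrite big_nil.
rewrite big_cons; apply: QD => //.
case: (c@_k) => n; first exact: QM.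
by rewrite NegzE mulrNz; apply/QN/QM.
Qed.

Section Norm.
Variable K : choiceType.
Implicit Types c a b : {malg int[K]}.

Lemma norm1_fset c (D : {fset K}) :
  (msupp c `<=` D)%fset -> norm1 c = (\sum_(k <- D) `|c@_k|)%N.
Proof.
move=> sD; rewrite /norm1; apply: big_fset_incl => // k _ kc.
by rewrite (mcoeff_outdom kc).
Qed.

Lemma norm1_0 : norm1 (0 : {malg int[K]}) = 0%N.
Proof. by rewrite /norm1 msupp0 big_seq_fset0. Qed.

Lemma norm1U (k : K) : norm1 << k >> = 1%N.
Proof. by rewrite /norm1 msuppU oner_eq0 big_seq_fset1 mcoeffUU. Qed.

Lemma norm1N c : norm1 (- c) = norm1 c.
Proof.
by rewrite /norm1 msuppN; apply: eq_bigr => k _; rewrite mcoeffN abszN.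
Qed.

Lemma norm1D a b : (norm1 (a + b)%R <= norm1 a + norm1 b)%N.
Proof.
set D := (msupp a `|` msupp b)%fset.
rewrite (@norm1_fset _ D) ?msuppD_le // (@norm1_fset a D) ?fsubsetUl //.
rewrite (@norm1_fset b D) ?fsubsetUr // -big_split /=.
by apply: leq_sum => k _; rewrite mcoeffD; lia.
Qed.

Lemma norm1_sum (I : Type) (r : seq I) (F : I -> {malg int[K]}) :
  (norm1 (\sum_(i <- r) F i)%R <= \sum_(i <- r) norm1 (F i))%N.
Proof.
elim: r => [|i r IH]; rewrite ?big_nil ?norm1_0 // !big_cons.
by apply: leq_trans (norm1D _ _) _; rewrite leq_add2l.
Qed.

Lemma norm1Mz a (m : int) : (norm1 (a *~ m)%R <= norm1 a * `|m|)%N.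
Proof.
have pos n : (norm1 (a *+ n)%R <= norm1 a * n)%N.
  elim: n => [|n IH]; first by rewrite mulr0n norm1_0.
  by rewrite mulrS mulnS; apply: leq_trans (norm1D _ _) _; rewrite leq_add2l.
by case: m => n; rewrite ?NegzE ?mulrNz ?norm1N ?abszN; apply: pos.
Qed.

End Norm.

Lemma norm1_zlin (K L : choiceType) (f : K -> {malg int[L]}) (M : nat) c :
  (forall k, (norm1 (f k) <= M)%N) -> (norm1 (zlin f c) <= M * norm1 c)%N.
Proof.
move=> fM; apply: leq_trans (norm1_sum _ _) _.
rewrite /norm1 big_distrr /=; apply: leq_sum => k _.
by apply: leq_trans (norm1Mz _ _) _; rewrite leq_mul2r fM orbT.
Qed.

Lemma mcoeffU_neq0 (K : choiceType) (k l : K) :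
  (<< k >> : {malg int[K]})@_l != 0 -> k = l.
Proof. by rewrite mcoeffU; have [//|_] := eqVneq k l; rewrite mulr0n eqxx. Qed.

(** An element of the support of the image of c comes from an element of the
support of c; this is how cells are located in what follows. *)
Lemma mcoeff_zlin_neq0 (K L : choiceType) (f : K -> {malg int[L]}) c l :
  (zlin f c)@_l != 0 -> exists2 k, c@_k != 0 & (f k)@_l != 0.
Proof.
move=> nz; apply: contrapT => no; move/eqP: nz; apply.
rewrite /zlin raddf_sum /= big1_seq // => k /andP[_ kc].
have -> : (f k *~ c@_k)@_l = ((f k)@_l : int) *~ c@_k.
  exact: (raddfMz (mcoeff l)).
have [->|fl] := eqVneq (f k)@_l 0; first by rewrite mul0rz.
by case: no; exists k => //; rewrite mcoeff_neq0.
Qed.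

Lemma size_msupp (K : choiceType) (c : {malg int[K]}) :
  (size (msupp c) <= norm1 c)%N.
Proof.
rewrite /norm1 -sum1_size big_seq [leqRHS]big_seq; apply: leq_sum => k.
by rewrite -mcoeff_neq0 absz_gt0.
Qed.

Section Push.
Variables (K L : choiceType) (p : K -> L).

Definition push : {malg int[K]} -> {malg int[L]} := zlin (fun k => << p k >>).

HB.instance Definition _ := GRing.Additive.on push.

Lemma pushU k : push << k >> = << p k >>.
Proof. exact: zlinU. Qed.

Lemma norm1_push c : (norm1 (push c) <= norm1 c)%N.
Proof. by rewrite -[leqRHS]mul1n norm1_zlin // => k; rewrite norm1U. Qed.

End Push.

Lemma zlin_push (K L : choiceType) (V : zmodType) (p : K -> L) (f : L -> V) c :
  zlin f (push p c) = zlin (f \o p) c.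
Proof.
rewrite /push zlin_comp; [|exact: raddf0|exact: raddfD].
by apply: zlin_ext => k /=; rewrite zlinU.
Qed.

Lemma push_id (K : choiceType) (p : K -> K) c : p =1 id -> push p c = c.
Proof.
by move=> e; rewrite -[RHS]zlin_id; apply: zlin_ext => k; rewrite e.
Qed.

Lemma push_push (K L M : choiceType) (p : K -> L) (q : L -> M) c :
  push q (push p c) = push (q \o p) c.
Proof. exact: zlin_push. Qed.

Section FilterChain.
Variables (K : choiceType) (p : pred K).

Definition filter_chain (c : {malg int[K]}) : {malg int[K]} :=
  zlin (fun k => if p k then << k >> else 0) c.

HB.instance Definition _ := GRing.isNmodMorphism.Build _ _ filter_chain
  (zlin_nmod_morphism _).

Lemma mcoeff_filter_chain c k : (filter_chain c)@_k = if p k then c@_k else 0.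
Proof.
rewrite /filter_chain; elim/malg_ind: c => [k'||a b Ha Hb].
- rewrite zlinU; case: (eqVneq k' k) => [->|ne]; first by case: (p k); rewrite ?mcoeff0.
  by case: (p k'); rewrite ?mcoeff0 !mcoeffU (negPf ne) if_same.
- by rewrite raddf0 mcoeff0 if_same.
- by rewrite raddfB !mcoeffB Ha Hb; case: (p k); rewrite ?subr0.
Qed.

End FilterChain.

Lemma filter_chainC (K : choiceType) (p : pred K) c :
  filter_chain p c + filter_chain (predC p) c = c.
Proof.
apply/malgP => k; rewrite mcoeffD !mcoeff_filter_chain /=.
by case: (p k); rewrite ?addr0 ?add0r.
Qed.

Lemma norm1_filter_chain (K : choiceType) (p : pred K) c :
  (norm1 (filter_chain p c) + norm1 (filter_chain (predC p) c))%N = norm1 c.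
Proof.
have sub q : (msupp (filter_chain q c) `<=` msupp c)%fset.
  apply/fsubsetP => k; rewrite -!mcoeff_neq0 mcoeff_filter_chain.
  by case: (q k); rewrite ?eqxx.
rewrite (norm1_fset (sub p)) (norm1_fset (sub (predC p))) -big_split /=.
apply: eq_bigr => k _; rewrite !mcoeff_filter_chain /=.
by case: (p k); rewrite ?addn0 ?add0n.
Qed.

(** * Decomposition of 1-cycles into closed edge paths *)

Section EdgePathChains.
Variable E : choiceType.

Definition step_chain (t : E * bool) : {malg int[E]} :=
  if t.2 then << t.1 >> else - << t.1 >>.

Definition path_chain (p : seq (E * bool)) : {malg int[E]} :=
  \sum_(t <- p) step_chain t.

Lemma path_chain_nil : path_chain [::] = 0.
Proof. exact: big_nil. Qed.

Lemma path_chain_cons t p : path_chain (t :: p) = step_chain t + path_chain p.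
Proof. exact: big_cons. Qed.

Lemma norm1_step_chain t : norm1 (step_chain t) = 1%N.
Proof. by rewrite /step_chain; case: ifP; rewrite ?norm1N norm1U. Qed.

Lemma norm1_path_chain p : (norm1 (path_chain p) <= size p)%N.
Proof.
elim: p => [|t p IH]; first by rewrite path_chain_nil norm1_0.
rewrite path_chain_cons; apply: leq_trans (norm1D _ _) _.
by rewrite norm1_step_chain add1n ltnS.
Qed.

Lemma mcoeff_path_chain_neq0 (p : seq (E * bool)) e :
  (path_chain p)@_e != 0 -> exists2 t, t \in p & t.1 = e.
Proof.
elim: p => [|t p IH]; first by rewrite path_chain_nil mcoeff0 eqxx.
have [<- _|te] := eqVneq t.1 e; first by exists t; rewrite ?mem_head.
rewrite path_chain_cons mcoeffD /step_chain.
have -> : (if t.2 then << t.1 >> else - << t.1 >>)@_e = (0 : int).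
  by case: t.2; rewrite ?mcoeffN mcoeffU (negPf te) ?oppr0.
by rewrite add0r => /IH[u up ue]; exists u => //; rewrite inE up orbT.
Qed.

(** A step that runs along an edge in the direction of its coefficient in c
can be removed from c without cancellation. *)
Lemma norm1_step_sub (c : {malg int[E]}) (e : E) (s : bool) :
  (if s then 0 < c@_e else c@_e < 0) ->
  (norm1 (c - step_chain (e, s))%R).+1 = norm1 c.
Proof.
move=> ce; have ec : e \in msupp c.
  by rewrite -mcoeff_neq0; apply/eqP => e0; move: ce; rewrite e0 ltxx if_same.
have se : (msupp (c - step_chain (e, s)) `<=` msupp c)%fset.
  apply: fsubset_trans (msuppB_le _ _) _; rewrite fsubUset fsubset_refl /=.
  by rewrite /step_chain; case: s {ce} => /=; rewrite ?msuppN msuppU oner_eq0 fsub1set.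
rewrite (norm1_fset se) /norm1 !(big_fsetD1 e ec) /= -addSn; congr addn.
  rewrite mcoeffB /step_chain; case: s ce {se} => /=; rewrite ?mcoeffN mcoeffUU; lia.
apply: eq_big_seq => k; rewrite !inE => /andP[ke _].
rewrite mcoeffB /step_chain; case: s {ce se} => /=;
  by rewrite ?mcoeffN mcoeffU eq_sym (negPf ke) ?oppr0 subr0.
Qed.

End EdgePathChains.

Section CycleDecomposition.
Variable X : complex2.
Implicit Types (c : {malg int[edge X]}) (u v : vert X) (p : seq (edge X * bool)).

HB.instance Definition _ := GRing.isNmodMorphism.Build _ _ (@boundary1 X)
  (zlin_nmod_morphism _).
HB.instance Definition _ := GRing.isNmodMorphism.Build _ _ (@boundary2 X)
  (zlin_nmod_morphism _).

Lemma boundary1U e : @boundary1 X << e >> = << tgt e >> - << src e >>.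
Proof. exact: zlinU. Qed.

Lemma boundary2U s : @boundary2 X << s >> = path_chain (attach s).
Proof. exact: zlinU. Qed.

Lemma boundary1_step t :
  @boundary1 X (step_chain t) = << step_tgt (@src X) (@tgt X) t >>
                              - << step_src (@src X) (@tgt X) t >>.
Proof.
rewrite /step_chain /step_tgt /step_src; case: t => e [] /=.
  exact: boundary1U.
by rewrite raddfN /= boundary1U opprB.
Qed.

Lemma boundary1_path u p v : edge_path (@src X) (@tgt X) u p v ->
  boundary1 (path_chain p) = << v >> - << u >>.
Proof.
elim: p u => [u /= ->|t p IH u /= [<- tp]].
  by rewrite path_chain_nil raddf0 subrr.
by rewrite path_chain_cons raddfD /= boundary1_step (IH _ tp) addrC subrKA.
Qed.

Lemma boundary1_attach s : boundary1 (path_chain (@attach X s)) = 0.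
Proof. by rewrite (boundary1_path (attach_closed s)) subrr. Qed.

Lemma boundary12 b : boundary1 (@boundary2 X b) = 0.
Proof.
elim/malg_ind: b => [s||a b Ha Hb].
- by rewrite boundary2U boundary1_attach.
- by rewrite !raddf0.
- by rewrite !raddfB /= Ha Hb subr0.
Qed.

(** Some edge contributes negatively to the coefficient of the boundary at u,
and traversing that edge in the direction of c leaves u. *)
Lemma boundary1_lt0_step c u : (boundary1 c)@_u < 0 ->
  exists2 t, step_src (@src X) (@tgt X) t = u &
             ((norm1 (c - step_chain t)%R).+1 = norm1 c)%N.
Proof.
move=> cu; apply: contrapT => no.
move: cu; apply/negP; rewrite -leNgt.
have E (V : choiceType) (a b : {malg int[V]}) (m : int) (k : V) :
    ((a - b) *~ m)@_k = (a@_k - b@_k) * m.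
  have -> : ((a - b) *~ m)@_k = ((a - b)@_k : int) *~ m.
    exact: (raddfMz (mcoeff k)).
  by rewrite -mulrzr intz mcoeffB.
rewrite /boundary1 /zlin raddf_sum /=; apply: sumr_ge0 => e _.
rewrite E !mcoeffU leNgt; apply/negP => lt0; apply: no.
have [se|se] := eqVneq (src e) u; have [te|te] := eqVneq (tgt e) u;
  rewrite ?se ?te ?eqxx ?(negPf se) ?(negPf te) /= in lt0.
- by rewrite subrr mul0r ltxx in lt0.
- by exists (e, true) => //; apply: norm1_step_sub; move: lt0; lia.
- by exists (e, false) => //; apply: norm1_step_sub; move: lt0; lia.
- by rewrite subrr mul0r ltxx in lt0.
Qed.

(** Follow the flow of c from u: as long as the current vertex is not v, the
boundary of the rest of the flow is negative there, so that the walk can go on.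
Every step uses up one unit of norm, so that the walk stops, and it can only
stop at v. *)
Lemma walk_along c u v : boundary1 c = << v >> - << u >> ->
  exists2 p, edge_path (@src X) (@tgt X) u p v &
             ((norm1 (c - path_chain p)%R + size p)%N = norm1 c)%N.
Proof.
have [n] := ubnP (norm1 c); elim: n c u => // n IH c u ltn bc.
have [->|uv] := eqVneq u v.
  by exists [::] => //; rewrite path_chain_nil subr0 addn0.
have [|t tu tn] := @boundary1_lt0_step c u.
  by rewrite bc mcoeffB !mcoeffU eqxx eq_sym (negPf uv).
have [||p pp np] := IH (c - step_chain t) (step_tgt (@src X) (@tgt X) t).
- by rewrite -tn in ltn.
- by rewrite raddfB /= bc boundary1_step tu opprB addrA subrK.
exists (t :: p) => //=; rewrite path_chain_cons opprD addrA addnS.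
by rewrite np tn.
Qed.

(** The walk that starts with any step along c returns to its origin; remove
this closed path and go on with the rest, whose norm is smaller. *)
Lemma cycle_decomposition c : is_cycle1 c ->
  exists ps : seq (seq (edge X * bool)),
    [/\ c = \sum_(p <- ps) path_chain p, (size ps <= norm1 c)%N &
        forall p, p \in ps -> (size p <= norm1 c)%N /\
           exists u, edge_path (@src X) (@tgt X) u p u].
Proof.
have [n] := ubnP (norm1 c); elim: n c => // n IH c ltn cyc.
have [c0|c0] := eqVneq c 0.
  by exists [::]; split; rewrite ?big_nil.
have [e ec] : exists e, c@_e != 0.
  apply: contrapT => no; move/eqP: c0; apply; apply/malgP => e; rewrite mcoeff0.
  by apply: contrapT => ce; apply: no; exists e; apply/eqP.
have [t tn] : exists t, (norm1 (c - step_chain t)%R).+1 = norm1 c.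
  by exists (e, 0 < c@_e); apply: norm1_step_sub; case: ltrgt0P ec.
set w := step_src (@src X) (@tgt X) t.
have [|p pp np] := @walk_along (c - step_chain t)
    (step_tgt (@src X) (@tgt X) t) w.
  by rewrite raddfB /= cyc boundary1_step sub0r opprB.
have lt : (norm1 (c - path_chain (t :: p))%R + (size p).+1 = norm1 c)%N.
  by rewrite path_chain_cons opprD addrA addnS np tn.
have [||ps [eq sz psP]] := IH (c - path_chain (t :: p)).
- by move: ltn; rewrite -lt addnS ltnS; apply: leq_ltn_trans; apply: leq_addr.
- by rewrite /is_cycle1 raddfB /= cyc path_chain_cons raddfD /= boundary1_step
    (boundary1_path pp) subrKA subrr subr0.
exists ((t :: p) :: ps); split.
- by rewrite big_cons -eq addrC subrK.
- by rewrite /= -lt; lia.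
move=> q; rewrite inE => /orP[/eqP ->|qps].
  by split; [rewrite -lt /=; lia | exists w].
have [sq cq] := psP q qps; split=> //; rewrite -lt; lia.
Qed.

End CycleDecomposition.

(** * Filling cycles *)

Section Fillings.
Variable X : complex2.

(** This expresses HArea c <= k without extended real numbers. *)
Definition fillable (k : nat) (c : {malg int[edge X]}) : Prop :=
  exists2 b, boundary2 b = c & (norm1 b <= k)%N.

Lemma fillable_le k l c : (k <= l)%N -> fillable k c -> fillable l c.
Proof. by move=> kl [b bc bk]; exists b => //; apply: leq_trans kl. Qed.

Lemma fillable0 k : fillable k 0.
Proof. by exists 0; rewrite ?raddf0 ?norm1_0. Qed.

Lemma fillableD k l c d :
  fillable k c -> fillable l d -> fillable (k + l) (c + d).
Proof.
move=> [a ac ak] [b bd bl]; exists (a + b); first by rewrite raddfD /= ac bd.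
by apply: leq_trans (norm1D _ _) _; rewrite leq_add.
Qed.

Lemma fillable_zlin (K : choiceType) (f : K -> {malg int[edge X]}) M c :
  (forall k, fillable M (f k)) -> fillable (M * norm1 c) (zlin f c).
Proof.
move=> fM.
have /choice[beta betaP] : forall k, exists b, boundary2 b = f k /\ (norm1 b <= M)%N.
  by move=> k; have [b ? ?] := fM k; exists b.
exists (zlin beta c); last by apply: norm1_zlin => k; case: (betaP k).
rewrite zlin_comp; [|exact: raddf0|exact: raddfD].
by apply: zlin_ext => k /=; case: (betaP k).
Qed.

Lemma fillable_sum (I : eqType) (r : seq I) (F : I -> {malg int[edge X]}) M :
  (forall i, i \in r -> fillable M (F i)) ->
  fillable (M * size r) (\sum_(i <- r) F i).
Proof.
elim: r => [|i r IH] rM; first by rewrite big_nil; apply: fillable0.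
rewrite big_cons /= mulnS; apply: fillableD; first by apply: rM; rewrite mem_head.
by apply: IH => j jr; apply: rM; rewrite inE jr orbT.
Qed.

Lemma fillable_cycle N M :
  (forall u p, edge_path (@src X) (@tgt X) u p u -> (size p <= N)%N ->
     fillable M (path_chain p)) ->
  forall c, is_cycle1 c -> (norm1 c <= N)%N -> fillable (M * N) c.
Proof.
move=> pM c /cycle_decomposition[ps [-> sz psP]] cN.
have le : (M * size ps <= M * N)%N by rewrite leq_mul2l (leq_trans sz) ?orbT.
apply: fillable_le le _; apply: fillable_sum => p /psP[sp [u up]].
exact: pM up (leq_trans sp cN).
Qed.

End Fillings.

(** * The action of the group on its Cayley complex *)

Lemma finite_bound (T : finType) (Q : T -> nat -> Prop) :
  (forall t k l, (k <= l)%N -> Q t k -> Q t l) ->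
  (forall t, exists k, Q t k) -> exists M, forall t, Q t M.
Proof.
move=> Qle /choice[f fP]; exists (\max_t f t) => t.
exact: Qle (leq_bigmax t) (fP t).
Qed.

Section Translation.
Variables (H : groupType) (K : choiceType).
Implicit Types (g h : H) (c : {malg int[(H * K)%type]}).

Definition left_translate g (k : H * K) : H * K := (g * k.1, k.2)%g.

Definition translate g : {malg int[(H * K)%type]} -> {malg int[(H * K)%type]} :=
  push (left_translate g).

HB.instance Definition _ g := GRing.isNmodMorphism.Build _ _ (translate g)
  (zlin_nmod_morphism _).

Lemma translateU g k : translate g << k >> = << (g * k.1, k.2)%g >>.
Proof. exact: pushU. Qed.

Lemma translate1 c : translate 1%g c = c.
Proof. by apply: push_id => -[h k] /=; rewrite /left_translate mul1g. Qed.

Lemma translateM g h c : translate (g * h)%g c = translate g (translate h c).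
Proof.
rewrite /translate push_push; apply: zlin_ext => k /=.
by rewrite /left_translate mulgA.
Qed.

Lemma translateK g : cancel (translate g) (translate g^-1%g).
Proof. by move=> c; rewrite -translateM mulVg translate1. Qed.

Lemma norm1_translate g c : norm1 (translate g c) = norm1 c.
Proof.
apply/eqP; rewrite eqn_leq norm1_push -{1}(translateK g c).
exact: norm1_push.
Qed.

End Translation.

Section CayleyComplexTranslation.
Variables (H : groupType) (P : presentation H).
Let X := cayley_complex P.
Let A := gens P.

Lemma path_chain_translate g v (w : word A) :
  path_chain (cayley_path (g * v)%g w) =
  translate g (path_chain (cayley_path v w)).
Proof.
elim: w v => [|[a s] w IH] v /=; first by rewrite path_chain_nil raddf0.
rewrite !path_chain_cons raddfD /= -IH mulgA; congr (_ + _).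
by rewrite /step_chain; case: s => /=; rewrite ?raddfN /= translateU ?mulgA.
Qed.

Lemma path_chain_base v (w : word A) :
  path_chain (cayley_path v w) = translate v (path_chain (cayley_path 1%g w)).
Proof. by rewrite -path_chain_translate mulg1. Qed.

Lemma boundary1_translate g (c : {malg int[edge X]}) :
  boundary1 (translate g c : {malg int[edge X]}) =
  push (fun h : H => (g * h)%g) (boundary1 c).
Proof.
elim/malg_ind: c => [e||a b Ha Hb].
- by rewrite translateU !boundary1U raddfB /= !pushU /cayley_tgt /= mulgA.
- by rewrite !raddf0.
- by rewrite !raddfB /= Ha Hb.
Qed.

Lemma cycle_translate g (c : {malg int[edge X]}) :
  is_cycle1 c -> is_cycle1 (translate g c : {malg int[edge X]}).
Proof. by rewrite /is_cycle1 boundary1_translate => ->; apply: raddf0. Qed.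

Lemma boundary2_translate g (b : {malg int[face X]}) :
  boundary2 (translate g b : {malg int[face X]}) = translate g (boundary2 b).
Proof.
elim/malg_ind: b => [s||a b Ha Hb].
- by rewrite translateU !boundary2U /= -path_chain_translate.
- by rewrite !raddf0.
- by rewrite !raddfB /= Ha Hb.
Qed.

Lemma fillable_translate g k (c : {malg int[edge X]}) :
  fillable k c -> fillable k (translate g c : {malg int[edge X]}).
Proof.
move=> [b bc bk]; exists (translate g b); first by rewrite boundary2_translate bc.
by rewrite norm1_translate.
Qed.

Lemma exists_way : generates A -> exists way : H -> {malg int[edge X]},
  forall v, boundary1 (way v) = << v >> - << 1%g >>.
Proof.
move=> genA; have /choice[w wP] : forall v : H, exists w : word A, word_eval w = v by [].
exists (fun v => path_chain (cayley_path 1%g (w v))) => v.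
apply: (@boundary1_path X).
rewrite -[X in edge_path _ _ _ _ X]wP -[X in edge_path _ _ _ _ X]mul1g.
exact: cayley_pathP.
Qed.

Lemma edge_path_cayley u p v :
  edge_path (@cayley_src H A) (@cayley_tgt H A) u p v ->
  exists w : word A,
    [/\ p = cayley_path u w, size w = size p & v = (u * word_eval w)%g].
Proof.
elim: p u => [u /= ->|[[x a] s] p IH u /= [tu tp]].
  by exists [::]; rewrite /= mulg1.
have [w [pw sw ->]] := IH _ tp.
exists ((a, s) :: w); split; rewrite /= ?sw //.
  rewrite pw; move: tu; rewrite /step_src /step_tgt /cayley_src /cayley_tgt /letter /=.
  by case: s {tp pw} => /= <- //; rewrite !mulgK.
move: tu; rewrite /step_src /step_tgt /cayley_src /cayley_tgt /letter /=.
by case: s {tp pw} => /= <-; rewrite ?mulgK mulgA // mulgK.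
Qed.

(** A loop is the translate of a loop at 1, and there are finitely many words of
length at most N. *)
Lemma cayley_loop_fillable N : H1_trivial X ->
  exists M, forall u p,
    edge_path (@cayley_src H A) (@cayley_tgt H A) u p u -> (size p <= N)%N ->
    fillable M (path_chain p : {malg int[edge X]}).
Proof.
move=> H1.
pose Q (t : {bseq N of (A * bool)%type}) M := word_eval (t : word A) = 1%g ->
  fillable M (path_chain (cayley_path 1%g t) : {malg int[edge X]}).
have [||M MP] := @finite_bound {bseq N of (A * bool)%type} Q.
- by move=> t k l kl tk t1; apply: fillable_le kl (tk t1).
- move=> t; have [t1|t1] := pselect (word_eval (t : word A) = 1%g); last by exists 0%N.
  have [|b bP] := H1 (path_chain (cayley_path 1%g t) : {malg int[edge X]}).
    rewrite /is_cycle1 (@boundary1_path X 1%g _ 1%g) ?subrr //.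
    by rewrite -[X in edge_path _ _ _ _ X]t1 -[X in edge_path _ _ _ _ X]mul1g; apply: cayley_pathP.
  by exists (norm1 b) => _; exists b.
exists M => u p /edge_path_cayley[w [-> sw ew]] sp.
rewrite path_chain_base; apply: fillable_translate.
rewrite -sw in sp.
apply: (MP (Bseq sp)) => /=.
by apply: (mulgI u); rewrite -ew mulg1.
Qed.

Lemma cayley_cycle_fillable n : H1_trivial X ->
  exists M, forall c : {malg int[edge X]}, is_cycle1 c -> (norm1 c <= n)%N ->
    fillable M c.
Proof.
move=> /(cayley_loop_fillable n)[M MP]; exists (M * n)%N => c cyc cn.
exact: (@fillable_cycle X n M MP).
Qed.

End CayleyComplexTranslation.

(** * Values of the filling function *)

Section DehnNumber.
Variables (R : realType) (X : complex2).

(** The value of FA as a relation, because in a general complex the supremum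
need not be finite; here it is finite and attained. *)
Definition is_FA (n k : nat) : Prop :=
  (forall c : {malg int[edge X]}, is_cycle1 c -> (norm1 c <= n)%N -> fillable k c)
  /\ exists c : {malg int[edge X]},
      [/\ is_cycle1 c, (norm1 c <= n)%N & forall l, fillable l c -> (k <= l)%N].

Lemma FA_is_FA n k : is_FA n k -> FA R X n = (k%:R)%:E.
Proof.
move=> [fill [c [cyc cn ck]]]; apply/eqP; rewrite eq_le; apply/andP; split.
  apply: ge_ereal_sup => _ [d [dc dn] <-].
  have [b bd bk] := fill d dc dn.
  apply: (@le_trans _ _ ((norm1 b)%:R)%:E); last by rewrite lee_fin ler_nat.
  by apply: ereal_inf_lbound; exists b.
apply: (@le_trans _ _ (HArea R c)); last by apply: ereal_sup_ubound; exists c.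
apply: le_ereal_inf_tmp => _ [b bc <-]; rewrite lee_fin ler_nat.
by apply: ck; exists b.
Qed.

Lemma is_FA_le m n k l : is_FA m k -> is_FA n l -> (m <= n)%N -> (k <= l)%N.
Proof.
move=> [_ [c [cyc cm ck]]] [fill _] mn; apply: ck.
by apply: fill cyc (leq_trans cm mn).
Qed.

Lemma ex_is_FA n M :
  (forall c : {malg int[edge X]}, is_cycle1 c -> (norm1 c <= n)%N -> fillable M c) ->
  exists k, is_FA n k.
Proof.
pose Q k := `[< forall c : {malg int[edge X]}, is_cycle1 c -> (norm1 c <= n)%N ->
  fillable k c >].
move=> MP; have exQ : exists k, Q k by exists M; apply/asboolP.
have [k /asboolP kP kmin] := ex_minnP exQ.
exists k; split=> //; case: k kP kmin => [|k] kP kmin.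
  by exists 0; split; rewrite ?norm1_0 // /is_cycle1 raddf0.
apply: contrapT => no; suff /kmin : Q k by rewrite ltnn.
apply/asboolP => c cyc cn; apply: contrapT => nk; apply: no.
exists c; split=> // l cl; rewrite ltnNge; apply/negP => lk.
exact: nk (fillable_le lk cl).
Qed.

End DehnNumber.

(** * Change of presentation *)

Section EquivariantFilling.
Variables (H : groupType) (P : presentation H).
Hypothesis H1P : H1_trivial (cayley_complex P).
Let X := cayley_complex P.

(** A translate of a filling is a filling, so it is enough to fill the finitely
many cycles based at 1. *)
Lemma equivariant_fillable (T : finType) (f : H * T -> {malg int[edge X]}) :
  (forall g t, f (g, t) = translate g (f (1%g, t))) ->
  (forall t, is_cycle1 (f (1%g, t))) ->
  exists M, forall s, fillable M (f s).
Proof.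
move=> fT fcyc.
have [||M MP] := @finite_bound T (fun t M => fillable M (f (1%g, t))).
- by move=> t k l; apply: fillable_le.
- by move=> t; have [b bP] := H1P (fcyc t); exists (norm1 b); exists b.
by exists M => -[g t]; rewrite fT; apply: fillable_translate.
Qed.

End EquivariantFilling.

Section ChangeOfGenerators.
Variables (H : groupType) (P Q : presentation H).
Variable sub : gens P -> word (gens Q).
Hypothesis subP : forall a, word_eval (sub a) = val a.
Let X := cayley_complex P.
Let Y := cayley_complex Q.

(** Replace each edge labeled a by the path with the same endpoints labeled
by the word sub a. *)
Definition substitution_chain : {malg int[edge X]} -> {malg int[edge Y]} :=
  zlin (fun e : H * gens P => path_chain (cayley_path e.1 (sub e.2))).

HB.instance Definition _ := GRing.isNmodMorphism.Build _ _ substitution_chain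
  (zlin_nmod_morphism _).

Lemma substitution_chainU e :
  substitution_chain << e >> = path_chain (cayley_path e.1 (sub e.2)).
Proof. exact: zlinU. Qed.

Lemma boundary1_substitution c :
  boundary1 (substitution_chain c) = boundary1 c :> {malg int[H]}.
Proof.
elim/malg_ind: c => [e||a b Ha Hb].
- rewrite substitution_chainU boundary1U.
  by rewrite (@boundary1_path Y e.1 _ (e.1 * val e.2)%g) // -subP; apply: cayley_pathP.
- by rewrite !raddf0.
- by rewrite !raddfB /= Ha Hb.
Qed.

Lemma substitution_cycle c : is_cycle1 c -> is_cycle1 (substitution_chain c).
Proof. by rewrite /is_cycle1 boundary1_substitution. Qed.

Lemma substitution_translate g (c : {malg int[edge X]}) :
  substitution_chain (translate g c) = translate g (substitution_chain c).
Proof.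
elim/malg_ind: c => [e||a b Ha Hb].
- by rewrite translateU !substitution_chainU -path_chain_translate.
- by rewrite !raddf0.
- by rewrite !raddfB /= Ha Hb.
Qed.

Lemma norm1_substitution :
  exists K, forall c, (norm1 (substitution_chain c) <= K * norm1 c)%N.
Proof.
exists (\max_a size (sub a)) => c; apply: norm1_zlin => e.
apply: leq_trans (norm1_path_chain _) _.
have -> : forall v (w : word (gens Q)), size (cayley_path v w) = size w.
  by move=> v w; elim: w v => //= s w IH v; rewrite IH.
exact: leq_bigmax.
Qed.

End ChangeOfGenerators.

Lemma exists_substitution (H : groupType) (P Q : presentation H) :
  generates (gens Q) ->
  exists sub : gens P -> word (gens Q), forall a, word_eval (sub a) = val a.
Proof.
move=> gQ; have /choice[f fP] : forall a : gens P,
    exists w : word (gens Q), word_eval w = val a by move=> a; apply: gQ.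
by exists f.
Qed.

Lemma FA_comparison (H : groupType) (P Q : presentation H) :
  homological_finite_presentation P -> homological_finite_presentation Q ->
  exists K M N, forall n k l,
    is_FA (cayley_complex P) (K * n) k -> is_FA (cayley_complex Q) n l ->
    (l <= M * k + N * n)%N.
Proof.
move=> [gP H1P] [gQ H1Q].
have [phi phiP] := @exists_substitution H P Q gQ.
have [psi psiP] := @exists_substitution H Q P gP.
have [K KP] := norm1_substitution psi.
have [||M MP] := @equivariant_fillable H Q H1Q (rels P : finType)
   (fun s => substitution_chain phi (@boundary2 (cayley_complex P) << s >>)).
- move=> g r; rewrite -substitution_translate -boundary2_translate.
  by rewrite translateU mulg1.
- by move=> r; apply: (substitution_cycle phiP); apply: boundary12.
have [||N NP] := @equivariant_fillable H Q H1Q (gens Q : finType)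
   (fun e => << e >> - substitution_chain phi (substitution_chain psi << e >>)).
- move=> g a; rewrite raddfB /= translateU mulg1 /=; congr (_ - _).
  by rewrite -!substitution_translate translateU mulg1.
- move=> a; rewrite /is_cycle1 raddfB /=.
  by rewrite !boundary1_substitution // subrr.
exists K, M, N => n k l [fillP _] [_ [c [cyc cn cl]]]; apply: cl.
have [||b bc bk] := fillP (substitution_chain psi c).
- exact: substitution_cycle.
- by apply: leq_trans (KP c) _; rewrite leq_mul2l cn orbT.
have -> : c = zlin (fun s => substitution_chain phi
                       (@boundary2 (cayley_complex P) << s >>)) b +
  zlin (fun e => << e >> - substitution_chain phi (substitution_chain psi << e >>)) c.
  have -> : zlin (fun s => substitution_chain phi
                       (@boundary2 (cayley_complex P) << s >>)) b =
            substitution_chain phi (boundary2 b).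
    elim/malg_ind: b {bc bk} => [s||a b Ha Hb]; first by rewrite zlinU.
      by rewrite !raddf0.
    by rewrite !raddfB /= Ha Hb.
  rewrite bc; move: c {cyc cn bc}; elim/malg_ind => [e||a d Ha Hd].
  - by rewrite zlinU addrC subrK.
  - by rewrite !raddf0 addr0.
  - by rewrite !raddfB /= {1}Ha {1}Hd opprD addrACA.
apply: fillableD.
  apply: fillable_le (fillable_zlin _ MP); by rewrite leq_mul2l bk orbT.
apply: fillable_le (fillable_zlin _ NP); by rewrite leq_mul2l cn orbT.
Qed.

(** * Superadditivity for infinite groups, linearity for finite ones *)

(** If each of the N layers between B 0 and B N met s, then s would have at
least N elements. *)
Lemma stable_layer (T : eqType) (s : seq T) (B : nat -> pred T) N :
  (forall j x, B j x -> B j.+1 x) -> (size s < N)%N ->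
  exists2 j, (j < N)%N & forall x, x \in s -> B j.+1 x -> B j x.
Proof.
move=> Bmono sN; apply: contrapT => no.
suff cnt j : (j <= N)%N -> (j <= count (B j) s)%N.
  by have := leq_trans (cnt N (leqnn N)) (count_size _ _); rewrite leqNgt sN.
elim: j => // j IH jN; apply: leq_ltn_trans (IH (ltnW jN)) _.
rewrite ltnNge; apply/negP => le; apply: no; exists j => // x xs Bx.
apply: contrapT => /negP nBx; move: le; apply/negP; rewrite -ltnNge.
elim: s xs {sN IH} => // y s IHs; rewrite inE => /orP[/eqP <-|ys] /=.
  by rewrite Bx (negPf nBx) add0n add1n ltnS; apply: sub_count; apply: Bmono.
rewrite -addnS; apply: leq_add (IHs ys).
by case By: (B j y); rewrite ?(Bmono _ _ By).
Qed.

Section Superadditivity.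
Variables (H : groupType) (P : presentation H).
Let X := cayley_complex P.

(** The finite set T bounds the size of faces: an edge of a face starting at v
starts at a point of v T. *)
Lemma face_reach : exists T : seq H, 1%g \in T /\
  forall (b : {malg int[face X]}) (e : edge X), (boundary2 b)@_e != 0 ->
    exists2 s : H * rels P, b@_s != 0 & exists2 t, t \in T & e.1 = (s.1 * t)%g.
Proof.
pose srcs (r : rels P) := [seq s.1.1 | s <- cayley_path 1%g (val r)].
exists (1%g :: flatten [seq srcs r | r : rels P]); split; first exact: mem_head.
move=> b e /mcoeff_zlin_neq0[s sb]; rewrite -/(path_chain (cayley_attach s)).
rewrite /cayley_attach path_chain_base => /mcoeff_zlin_neq0[e' e'p /mcoeffU_neq0 ee].
have [t tp te'] := mcoeff_path_chain_neq0 e'p.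
exists s => //; exists e'.1; last by rewrite -ee.
rewrite inE; apply/orP; right; apply/flattenP; exists (srcs s.2).
  by apply: (map_f srcs); rewrite mem_enum.
by rewrite -te'; apply: map_f.
Qed.

(** Grow finite sets B 0, B 1, ... around c1 so that a face based outside
B (j+1) shares no edge with a face based in B j.  An element g that moves c2
away from B N does for all fillings of area less than N: such a filling has no
face in some layer between B j and B (j+1), and the faces based in B j form one
part of the required decomposition. *)
Lemma filling_splits (c1 c2 : {malg int[edge X]}) N :
  (forall s : seq H, exists g, g \notin s) ->
  exists g, forall k, (k < N)%N -> fillable k (c1 + translate g c2) ->
    exists k1 k2, [/\ (k1 + k2 <= k)%N, fillable k1 c1 & fillable k2 c2].
Proof.
move=> infH; have [T [T1 TP]] := face_reach.
pose spread (s : seq H) := [seq (u * t)%g | u <- s, t <- T].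
pose B j := iter j (fun s => [seq (y * t^-1)%g | y <- spread s, t <- T])
                 [seq e.1 | e <- msupp c1 : seq (H * gens P)].
have spreadI s u t : u \in s -> t \in T -> (u * t)%g \in spread s.
  by move=> us tT; apply: allpairs_f.
have BS j u t t' : u \in B j -> t \in T -> t' \in T -> (u * t * t'^-1)%g \in B j.+1.
  by move=> uj tT tT'; apply: (allpairs_f (fun y t => (y * t^-1)%g)) => //; apply: spreadI.
have Bmono j u : u \in B j -> u \in B j.+1.
  by move=> /BS /(_ T1 T1); rewrite mulgK.
have Ble i j u : (i <= j)%N -> u \in B i -> u \in B j.
  move=> /subnKC <-; elim: (j - i)%N => [|d IH] ui; first by rewrite addn0.
  by rewrite addnS; apply/Bmono/IH.
have spread_le i j x : (i <= j)%N -> x \in spread (B i) -> x \in spread (B j).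
  by move=> ij /allpairsP[[u t] /= [ui tT ->]]; apply: spreadI => //; apply: Ble ui.
(* This g moves the sources of c2 away from spread (B N). *)
have [g gP] := infH [seq (y * x^-1)%g | y <- spread (B N),
                           x <- [seq e.1 | e <- msupp c2 : seq (H * gens P)]].
have far (e : edge X) : e.1 \in spread (B N) -> (translate g c2)@_e = 0.
  move=> eN; apply/eqP; apply: contraNT gP => /mcoeff_zlin_neq0[e2 e2c /mcoeffU_neq0 ee].
  have -> : g = (e.1 * e2.1^-1)%g by rewrite -ee /= mulgK.
  apply: (allpairs_f (fun y x => (y * x^-1)%g)) => //; apply: map_f.
  by rewrite -mcoeff_neq0.
exists g => k kN [b bc bk].
(* The support of b misses the layer between B j and B (j+1). *)
have [||j jN jP] := @stable_layer _ (msupp b) (fun j s => s.1 \in B j) N.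
- by move=> j s; apply: Bmono.
- exact: leq_ltn_trans (leq_trans (size_msupp b) bk) kN.
pose inB (s : face X) := s.1 \in B j.
have eb : boundary2 (filter_chain inB b) + boundary2 (filter_chain (predC inB) b) = boundary2 b.
  by rewrite -raddfD /= filter_chainC.
(* At an edge starting in spread (B j) the outer part and g.c2 vanish; at any
   other edge the inner part and c1 vanish.  Hence the inner part fills c1. *)
have bin : boundary2 (filter_chain inB b) = c1.
  apply/malgP => e; have [ej|ej] := boolP (e.1 \in spread (B j)).
    have out0 : (boundary2 (filter_chain (predC inB) b))@_e = 0.
      apply/eqP/negPn/negP => /TP[s sb [t tT est]].
      move: sb; rewrite mcoeff_filter_chain /=; case: ifP => [/negP sj sb|_]; last by rewrite eqxx.
      apply: sj; apply: jP; first by rewrite -mcoeff_neq0.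
      have /allpairsP[[u t'] /= [uj tT' eut]] := ej.
      have -> : s.1 = (u * t' * t^-1)%g by rewrite -eut est mulgK.
      exact: BS.
    have c20 : (translate g c2)@_e = 0.
      by apply: far; apply: spread_le ej; apply: ltnW.
    rewrite -[LHS]addr0 -out0 -mcoeffD eb bc mcoeffD c20 addr0.
    by [].
  have in0 : (boundary2 (filter_chain inB b))@_e = 0.
    apply/eqP; apply: contraNT ej => /TP[s sb [t tT ->]]; apply: spreadI => //.
    by move: sb; rewrite mcoeff_filter_chain /inB; case: ifP => //; rewrite eqxx.
  rewrite in0; apply/esym/eqP; apply: contraNT ej; rewrite mcoeff_neq0 => ec.
  rewrite -[e.1]mulg1; apply: spreadI => //; apply: (@Ble 0%N) => //.
  exact: (map_f (fun e : H * gens P => e.1)).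
exists (norm1 (filter_chain inB b)), (norm1 (filter_chain (predC inB) b)); split.
- by rewrite norm1_filter_chain.
- by exists (filter_chain inB b).
rewrite -(translateK g c2); apply: fillable_translate.
exists (filter_chain (predC inB) b) => //.
by apply: (addrI c1); rewrite -bc -eb bin.
Qed.

Lemma FA_superadditive m n k l p :
  (forall s : seq H, exists g, g \notin s) ->
  is_FA X m k -> is_FA X n l -> is_FA X (m + n) p -> (k + l <= p)%N.
Proof.
move=> infH [_ [c1 [cyc1 c1m c1k]]] [_ [c2 [cyc2 c2n c2l]]] [fill _].
have [g gP] := filling_splits c1 c2 (k + l) infH.
rewrite leqNgt; apply/negP => pkl.
have [|k1 [k2 [le f1 f2]]] := gP p pkl.
  apply: fill; first by rewrite /is_cycle1 raddfD /= cyc1 (cycle_translate g cyc2) addr0.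
  by apply: leq_trans (norm1D _ _) _; rewrite norm1_translate leq_add.
have := leq_trans (leq_add (c1k _ f1) (c2l _ f2)) le.
by rewrite leqNgt pkl.
Qed.

(** Every edge e is completed to a loop by paths from 1 to its endpoints.  In a
cycle c the added paths cancel, so that c is the same combination of loops as of
edges; since the group is finite, there are finitely many loops. *)
Lemma FA_finite_group (s : seq H) :
  (forall g, g \in s) -> homological_finite_presentation P ->
  exists C, forall n k, is_FA X n k -> (k <= C * n)%N.
Proof.
move=> sP [gP H1P].
have [way bway] := exists_way gP.
pose loop (e : edge X) : {malg int[edge X]} := << e >> - (way (tgt e) - way (src e)).
have lcyc e : is_cycle1 (loop e).
  rewrite /is_cycle1 !raddfB /= boundary1U !bway !opprB.
  have alg (x y z : {malg int[H]}) : x - y + (z - x + (y - z)) = 0.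
    by rewrite [z - x + _]addrC !subrKA subrr.
  exact: alg.
have [||C CP] := @finite_bound (seq_sub s * gens P)%type
   (fun x C => fillable C (loop (ssval x.1, x.2))).
- by move=> x k l; apply: fillable_le.
- by move=> x; have [b bP] := H1P _ (lcyc (ssval x.1, x.2)); exists (norm1 b); exists b.
exists C => n k [_ [c [cyc cn ck]]]; apply: ck.
have -> : c = zlin loop c.
  have -> : zlin loop c = c - zlin way (boundary1 c).
    elim/malg_ind: c {cyc cn} => [e||a d Ha Hd].
    - by rewrite zlinU boundary1U raddfB /= !zlinU.
    - by rewrite !raddf0 addr0.
    - rewrite raddfB /= Ha Hd (raddfB (@boundary1 X)) /= (raddfB (zlin way)) /=.
      by rewrite !opprD !opprK addrACA.
  by rewrite (cyc : boundary1 c = 0) zlin0 subr0.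
apply: (@fillable_le _ (C * norm1 c)); first by rewrite leq_mul2l cn orbT.
by apply: fillable_zlin => -[h a]; apply: (CP (SeqSub (sP h), a)).
Qed.

End Superadditivity.

(** * Modules over the group ring *)

Section DualBasis.
Variables (S : nzRingType) (M : lmodType S).

Section Combination.
Variables (n : nat) (v : 'I_n -> M).
Definition row_combination (x : 'rV[S]_n) : M := \sum_j x 0 j *: v j.
Fact row_combination_linear : linear row_combination.
Proof.
move=> a x y; rewrite /row_combination scaler_sumr -big_split /=.
by apply: eq_bigr => j _; rewrite !mxE scalerDl scalerA.
Qed.
HB.instance Definition _ := GRing.isLinear.Build S 'rV[S]_n M _ row_combination
  row_combination_linear.
End Combination.

Section Coordinate.
Variables (n : nat) (f : {linear M -> 'rV[S]_n}) (j : 'I_n).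
Definition row_coordinate (x : M) : S^o := f x 0 j.
Fact row_coordinate_linear : linear row_coordinate.
Proof. by move=> a x y; rewrite /row_coordinate linearP !mxE. Qed.
HB.instance Definition _ := GRing.isLinear.Build S M S^o _ row_coordinate
  row_coordinate_linear.
End Coordinate.

(** A section of the surjection from a free module given by the generators v;
a linear map on the free module becomes one on M by composition with it. *)
Lemma dual_basis : finitely_generated M -> projective M ->
  exists n (v : 'I_n -> M) (s : 'I_n -> {linear M -> S^o}),
    forall x, x = \sum_j s j x *: v j.
Proof.
move=> [n [v vP]] pM.
have [|f fP] := pM 'rV[S]_n M (row_combination v) idfun.
  move=> y; have [a ->] := vP y; exists (\row_j a j).
  by apply: eq_bigr => j _; rewrite mxE.
exists n, v, (fun j => row_coordinate f j).
by move=> x; rewrite -[LHS]fP.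
Qed.

End DualBasis.

Section GroupRingAction.
Variables (H : groupType) (K : choiceType).
Implicit Types (x y : group_ring H) (c d : {malg int[(H * K)%type]}).

(** The chains on H * K, with H acting on the first factor, as a module over
the group ring. *)
Definition chain_act x c : {malg int[(H * K)%type]} :=
  zlin (fun g : H => translate g c) x.

Fact chain_act_nmod_morphism x : nmod_morphism (chain_act x).
Proof.
split=> [|c d]; rewrite /chain_act.
  by rewrite /zlin big1 // => g _; rewrite raddf0 mul0rz.
by rewrite -zlinDf; apply: zlin_ext => g; rewrite raddfD.
Qed.
HB.instance Definition _ x := GRing.isNmodMorphism.Build _ _ (chain_act x)
  (chain_act_nmod_morphism x).

Lemma chain_actDl c x y : chain_act (x + y) c = chain_act x c + chain_act y c.
Proof. exact: zlinD. Qed.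

Lemma chain_actBl c x y : chain_act (x - y) c = chain_act x c - chain_act y c.
Proof. exact: (raddfB (zlin _)). Qed.

Lemma chain_act0l c : chain_act 0 c = 0.
Proof. exact: zlin0. Qed.

Lemma chain_actU g c : chain_act << g >> c = translate g c.
Proof. exact: zlinU. Qed.

Lemma group_ringMUU (g h : H) :
  (<< g >> : group_ring H) * << h >> = << (g * h)%g >>.
Proof. exact: gr_mulUU. Qed.

Lemma chain_actM x y c : chain_act (x * y) c = chain_act x (chain_act y c).
Proof.
elim/(@malg_ind H) : x => [g||a b Ha Hb].
- elim/(@malg_ind H) : y => [h||a b Ha Hb].
  + by rewrite group_ringMUU !chain_actU translateM.
  + by rewrite mulr0 chain_act0l raddf0.
  + by rewrite mulrBr !chain_actBl raddfB /= Ha Hb.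
- by rewrite mul0r !chain_act0l.
- by rewrite mulrBl !chain_actBl Ha Hb.
Qed.

Lemma chain_act_basis (k : K) (g : H) :
  chain_act << g >> << (1%g, k) >> = << (g, k) >>.
Proof. by rewrite chain_actU translateU mulg1. Qed.

End GroupRingAction.

(** The chains on H * K are a free module on the elements (1, k), so that an
equivariant map is determined by its values there. *)
Lemma equivariant_expansion (H : groupType) (K : finType) (V : zmodType)
    (F : {malg int[(H * K)%type]} -> V) (act : group_ring H -> V -> V) :
  {morph F : a b / a - b} ->
  (forall v, {morph act^~ v : a b / a - b}) ->
  (forall g k, F << (g, k) >> = act << g >> (F << (1%g, k) >>)) ->
  forall c, exists a : K -> group_ring H,
    F c = \sum_k act (a k) (F << (1%g, k) >>).
Proof.
move=> FB actB FE.
have act0 v : act 0 v = 0 by rewrite -[0 in LHS](subrr 0) actB subrr.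
have F0 : F 0 = 0 by rewrite -[0 in LHS](subrr 0) FB subrr.
elim/malg_ind => [[g k]||c d [a aP] [b bP]].
- exists (fun l => if l == k then << g >> else 0).
  rewrite (bigD1 k) //= eqxx -FE big1 ?addr0 // => l /negPf ->; exact: act0.
- by exists (fun=> 0); rewrite F0 big1.
- exists (fun k => a k - b k); rewrite FB aP bP -sumrB.
  by apply: eq_bigr => k _; rewrite actB.
Qed.

Section CayleyGraphModule.
Variables (H : groupType) (P : presentation H).
Let X := cayley_complex P.

Lemma boundary1_act (x : group_ring H) (c : {malg int[edge X]}) :
  boundary1 (chain_act x c : {malg int[edge X]}) =
  x * (boundary1 c : group_ring H) :> group_ring H.
Proof.
elim/(@malg_ind H) : x => [g||a b Ha Hb].
- rewrite chain_actU boundary1_translate; exact/esym/gr_mulUl.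
- by rewrite chain_act0l raddf0 mul0r.
- by rewrite chain_actBl raddfB /= Ha Hb mulrBl.
Qed.

Lemma boundary2_act (x : group_ring H) (b : {malg int[face X]}) :
  boundary2 (chain_act x b : {malg int[face X]}) = chain_act x (boundary2 b).
Proof.
elim/(@malg_ind H) : x => [g||a d Ha Hb].
- by rewrite !chain_actU boundary2_translate.
- by rewrite !chain_act0l raddf0.
- by rewrite !chain_actBl raddfB /= Ha Hb.
Qed.

Hypothesis genP : generates (gens P).

(** Connectedness of the Cayley graph: x is the boundary of the sum of the
paths from 1 to the elements of its support. *)
Lemma augmentation_ideal_boundary (x : group_ring H) :
  augmentation x = 0 -> exists c : {malg int[edge X]}, boundary1 c = x.
Proof.
move=> x0; have [way wayP] := exists_way genP; exists (zlin way x).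
suff -> : boundary1 (zlin way x) = x - << 1%g >> *~ augmentation x.
  by rewrite x0 mulr0z subr0.
rewrite /augmentation; elim/(@malg_ind H) : x {x0} => [g||a b Ha Hb].
- by rewrite !zlinU wayP mulr1z.
- by rewrite !zlin0 mulr0z !raddf0 addr0.
- by rewrite !raddfB /= Ha Hb !opprD !opprK addrACA.
Qed.

End CayleyGraphModule.

Section AugmentationLift.
Variable H : groupType.

HB.instance Definition _ := GRing.isNmodMorphism.Build (group_ring H) int
  (@augmentation H) (zlin_nmod_morphism _).

Lemma augmentationU (g : H) : augmentation << g >> = 1.
Proof. exact: zlinU. Qed.

Definition augmentation_module (x : (group_ring H)^o) : trivial_module H :=
  augmentation x.

Fact augmentation_module_linear : linear augmentation_module.
Proof.
by move=> a x y; rewrite /augmentation_module augmentationD augmentationM.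
Qed.
HB.instance Definition _ := GRing.isLinear.Build (group_ring H)
  (group_ring H)^o (trivial_module H) _ augmentation_module
  augmentation_module_linear.

(** The degree 0 part of a chain map from a resolution to any complex that
starts with Z[H] and its augmentation. *)
Lemma augmentation_lift (M : lmodType (group_ring H))
    (eps : {linear M -> trivial_module H}) :
  projective M -> exists g : {linear M -> (group_ring H)^o},
    forall x, augmentation (g x) = eps x.
Proof.
move=> pM; apply: (pM _ _ augmentation_module eps) => n.
exists ((1 : group_ring H) *~ (n : int)); rewrite /augmentation_module.
apply: etrans (raddfMz (@augmentation H) (n : int) (1 : group_ring H)) _.
by rewrite /= augmentation1 intz.
Qed.

End AugmentationLift.

(** * Groups of type FP_2 have homological finite presentations *)

Section FiniteGeneration.
Variables (H : groupType) (P1 P0 : lmodType (group_ring H)).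
Variables (d1 : {linear P1 -> P0}) (eps : {linear P0 -> trivial_module H}).
Hypotheses (fgP1 : finitely_generated P1) (pP0 : projective P0).
Hypotheses (ex10 : exact_at d1 eps) (eps_surj : forall n, exists x, eps x = n).

Lemma eps_scale (x : group_ring H) (p : P0) :
  eps p = 1 :> int -> eps (x *: p) = augmentation x :> int.
Proof. by move=> p1; rewrite linearZ /= p1; apply: mulr1. Qed.

(** The maps x |-> x *: p and g between Z[H] and P0 commute with the
augmentations.  The element x is the sum of x (1 - g p) and of g (x *: p), and
if x has augmentation 0, then x *: p lifts to P1.  Thus 1 - g p and the images
of the generators of P1 generate the ideal. *)
Lemma augmentation_ideal_fg :
  exists (I : finType) (t : I -> group_ring H),
    (forall i, augmentation (t i) = 0) /\
    forall x, augmentation x = 0 ->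
      exists a : I -> group_ring H, x = \sum_i a i * t i.
Proof.
have [g gP] := augmentation_lift eps pP0.
have [p p1] := eps_surj (1 : int).
have [n [v vP]] := fgP1.
exists (option 'I_n), (fun o => if o is Some j then g (d1 (v j)) else 1 - g p).
split=> [[j|]|x x0].
- by rewrite gP; apply/ex10; exists (v j).
- have /eqP := gP p; rewrite p1 => /eqP gp1.
  by rewrite raddfB /= augmentation1 gp1 subrr.
have /ex10[y yP] : eps (x *: p) = 0 by rewrite eps_scale.
have [a ya] := vP y.
exists (fun o => if o is Some j then a j else x).
rewrite (bigD1 None) //= -[LHS]mulr1 -{1}[1](subrK (g p : group_ring H)).
rewrite mulrDr; congr (_ + _).
rewrite (reindex_omap Some id) /=; last by case.
have -> : x * g p = g (x *: p) by rewrite linearZ.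
rewrite -yP ya !raddf_sum /=; apply: eq_big => [j|j _]; first by rewrite eqxx.
by rewrite !linearZ.
Qed.

(** Let G be the subgroup generated by the supports of generators t i of the
augmentation ideal.  For h in H, the support of h * t i lies in G if h does and is
disjoint from G otherwise, and the coefficients of t i add up to 0.  So the sum
chi of the coefficients at elements of G vanishes on the augmentation ideal, in
particular on h - 1, whence h lies in G. *)
Lemma FP1_generates : exists A : {fset H}, generates A.
Proof.
have [I [t [t0 tP]]] := augmentation_ideal_fg.
exists [fset h in flatten [seq (msupp (t i) : seq H) | i <- enum I]]%fset.
set A := (X in generates X).
pose G h := `[< exists w : word A, word_eval w = h >].
have GM h (a : A) : G (h * val a)%g = G h.
  have catE (w1 w2 : word A) : word_eval (w1 ++ w2) = (word_eval w1 * word_eval w2)%g.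
    by elim: w1 => [|s w1 /= ->]; rewrite ?mul1g // mulgA.
  apply/asboolP/asboolP => -[w wh].
    exists (w ++ [:: (a, false)]); rewrite catE wh /= /letter /= mulg1.
    by rewrite mulgK.
  by exists (w ++ [:: (a, true)]); rewrite catE wh /= /letter /= mulg1.
pose chi (x : group_ring H) : int := zlin (fun h => (G h)%:R) x.
have chi_shift (h : H) i : chi ((<< h >> : group_ring H) * t i) = 0.
  rewrite [_ * _](gr_mulUl h (t i)) /chi.
  have -> : zlin (fun h' : H => << (h * h')%g >>) (t i) = push (fun h' => (h * h')%g) (t i) by [].
  rewrite zlin_push.
  suff -> : zlin ((fun h => (G h)%:R : int) \o (fun h' => (h * h')%g)) (t i) =
            (G h)%:R * augmentation (t i) by rewrite t0 mulr0.
  rewrite /augmentation /zlin big_distrr /=; apply: eq_big_seq => k kt.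
  have kA : k \in A.
    by rewrite in_fset; apply/flatten_mapP; exists i; rewrite ?mem_enum.
  by rewrite (GM h [` kA]%fset) mulrzr.
have chiM a i : chi (a * t i) = 0.
  elim/(@malg_ind H) : a => [h||a b Ha Hb]; first exact: chi_shift.
    by rewrite mul0r; apply: zlin0.
  by rewrite mulrBl /chi raddfB /=; rewrite /chi in Ha Hb; rewrite Ha Hb.
move=> h; suff : G h by move/asboolP.
have G1 : G 1%g by apply/asboolP; exists [::].
have [|a aP] := tP (<< h >> - << 1%g >>).
  by rewrite raddfB /= !augmentationU subrr.
have : chi (<< h >> - << 1%g >>) = 0.
  by rewrite aP /chi raddf_sum /= big1 // => i _; apply: chiM.
by rewrite /chi raddfB /= !zlinU G1; case: (G h).
Qed.

End FiniteGeneration.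

Section CycleModule.
Variables (H : groupType) (P2 P1 P0 : lmodType (group_ring H)).
Variables (d2 : {linear P2 -> P1}) (d1 : {linear P1 -> P0}).
Variable eps : {linear P0 -> trivial_module H}.
Hypotheses (fgP2 : finitely_generated P2).
Hypotheses (fgP1 : finitely_generated P1) (pP1 : projective P1).
Hypotheses (pP0 : projective P0).
Hypotheses (ex21 : exact_at d2 d1) (ex10 : exact_at d1 eps).
Hypothesis eps_surj : forall n, exists x, eps x = n.

Variable P : presentation H.
Hypothesis genP : generates (gens P).
Let X := cayley_complex P.
Local Notation C1 := {malg int[edge X]}.

(** There are chain maps f and g between the chain complex of the Cayley graph
and the given resolution, and in degree 0 the map g f is homotopic to the
identity.  A cycle c is the sum of g1 (f1 c) and t c, where t, which is 1 - g f up to the homotopy, takes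
values in cycles on all chains.  As f1 c is a cycle of the resolution, it comes
from P2.  Thus the images under t of the edges at 1 and the images of the
generators of P2 generate the module of cycles. *)
Lemma cycle_module_fg :
  exists (I : finType) (z : I -> C1), (forall i, is_cycle1 (z i)) /\
    forall c : C1, is_cycle1 c -> exists a : I -> group_ring H,
      c = \sum_i chain_act (a i) (z i).
Proof.
have [p p1] := eps_surj (1 : int).
have [g0 g0P] := augmentation_lift eps pP0.
(* f1 lies over the map f0 : x |-> x *: p. *)
have /choice[q qP] : forall a : gens P, exists q, d1 q = ((<< val a >> : group_ring H) - 1) *: p.
  by move=> a; apply/ex10; rewrite eps_scale // raddfB /= augmentationU augmentation1 subrr.
pose f1 : C1 -> P1 := zlin (fun e : H * gens P => (<< e.1 >> : group_ring H) *: q e.2).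
have f1B : {morph f1 : a b / a - b} by move=> a b; apply: raddfB.
have f1U g a : f1 << (g, a) >> = (<< g >> : group_ring H) *: f1 << (1%g, a) >>.
  by rewrite /f1 !zlinU scale1r.
have d1f1 c : d1 (f1 c) = (boundary1 c : group_ring H) *: p.
  elim/malg_ind: c => [[g a]||a b Ha Hb].
  - rewrite /f1 zlinU linearZ /= qP scalerA boundary1U mulrBr mulr1.
    by rewrite group_ringMUU.
  - by rewrite /f1 zlin0 !raddf0 scale0r.
  - by rewrite f1B !raddfB /= Ha Hb scalerBl.
(* g1 lies over g0.  It is the section of the free cover of P1 followed by the
   map with the values e j on the basis; these exist because the Cayley graph is
   connected. *)
have [n [v [s sP]]] := dual_basis fgP1 pP1.
have /choice[e eP] : forall j, exists e : C1, boundary1 e = g0 (d1 (v j)).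
  move=> j; apply: augmentation_ideal_boundary => //; rewrite g0P.
  by apply/ex10; exists (v j).
pose g1 (y : P1) : C1 := \sum_j chain_act (s j y) (e j).
have g1D : {morph g1 : x y / x + y}.
  move=> x y; rewrite /g1 -big_split; apply: eq_bigr => j _.
  by rewrite raddfD /= chain_actDl.
have g10 : g1 0 = 0 by apply: (addrI (g1 0)); rewrite -g1D !addr0.
have g1B : {morph g1 : x y / x - y}.
  by move=> x y; apply: (addIr (g1 y)); rewrite -g1D !subrK.
have g1Z a y : g1 (a *: y) = chain_act a (g1 y).
  rewrite /g1 raddf_sum; apply: eq_bigr => j _.
  by rewrite /= linearZ /= -chain_actM.
have bg1 y : boundary1 (g1 y) = g0 (d1 y) :> group_ring H.
  rewrite {2}(sP y) /g1 !raddf_sum /=; apply: eq_bigr => j _.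
  by rewrite boundary1_act eP !linearZ.
(* The homotopy sends x to x.e0. *)
have [e0 e0P] : exists e0 : C1, boundary1 e0 = 1 - g0 p :> group_ring H.
  apply: augmentation_ideal_boundary => //.
  by rewrite raddfB /= augmentation1 g0P p1; apply: subrr.
pose t (c : C1) : C1 := c - g1 (f1 c) - chain_act (boundary1 c : group_ring H) e0.
have tB : {morph t : a b / a - b}.
  move=> a b; rewrite /t f1B g1B (raddfB (@boundary1 X)) /= chain_actBl.
  by rewrite !opprD !opprK [RHS]addrACA; congr (_ + _); rewrite addrACA.
have tU g a : t << (g, a) >> = chain_act << g >> (t << (1%g, a) >>).
  rewrite /t !raddfB /= -chain_actM -g1Z -f1U -boundary1_act.
  by rewrite !chain_act_basis.
have bt c : boundary1 (t c) = 0.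
  rewrite /t !raddfB /= bg1 d1f1 boundary1_act e0P linearZ /= mulrBr mulr1.
  exact: subrr.
have [m [w wP]] := fgP2.
exists (gens P + 'I_m)%type, (fun i => match i with
  | inl a => t << (1%g, a) >> | inr j => g1 (d2 (w j)) end).
split=> [[a|j]|c cyc]; first exact: bt.
  have -> : is_cycle1 (g1 (d2 (w j))) = (g0 (d1 (d2 (w j))) = 0) by rewrite -bg1.
  by have -> : d1 (d2 (w j)) = 0; [apply/ex21; exists (w j) | apply: raddf0].
have [|a aP] := @equivariant_expansion _ (gens P) _ t
  (fun x c => chain_act x c) tB _ tU c.
  by move=> u x y; apply: chain_actBl.
have /ex21[y yP] : d1 (f1 c) = 0 by rewrite d1f1 (cyc : _ = 0) scale0r.
have [b yb] := wP y.
exists (fun i => match i with inl k => a k | inr j => b j end).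
rewrite big_sumType /= -aP.
have -> : \sum_j chain_act (b j) (g1 (d2 (w j))) = g1 (f1 c).
  rewrite -yP yb raddf_sum /= (big_morph g1 g1D g10).
  by apply: eq_bigr => j _; rewrite linearZ /= g1Z.
by rewrite /t (cyc : _ = 0) chain_act0l subr0 subrK.
Qed.

End CycleModule.

(** By cycle_decomposition a cycle of norm at most N is a sum of loops of length
at most N, and each of these bounds a face when all trivial words of length at
most N are relators. *)
Lemma FP2_presentation (H : groupType) :
  type_FP2 H -> exists P : presentation H, homological_finite_presentation P.
Proof.
move=> [P2 [P1 [P0 [d2 [d1 [eps [[fg2 _] [fg1 pP1] [_ pP0]]]]]]]].
move=> [ex21 ex10 eps_surj].
have [A genA] := FP1_generates fg1 pP0 ex10 eps_surj.
have no_rels r : r \in (fset0 : {fset word A}) -> word_eval r = 1%g by [].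
have [I [z [zcyc zP]]] := @cycle_module_fg H P2 P1 P0 d2 d1 eps fg2 fg1 pP1 pP0
  ex21 ex10 eps_surj (Presentation no_rels) genA.
pose N := (\max_i norm1 (z i))%N.
pose short := [seq (val t : word A) | t <- [seq t <- enum {bseq N of (A * bool)%type} |
   word_eval (val t : word A) == 1%g]].
pose R0 : {fset word A} := [fset w in short]%fset.
have R0P (w : word A) : (w \in R0) = (size w <= N)%N && (word_eval w == 1%g).
  rewrite in_fset; apply/mapP/andP => [[t]|[wN w1]].
    by rewrite mem_filter => /andP[t1 _] ->; split=> //; apply: size_bseq.
  by exists (Bseq wN) => //; rewrite mem_filter w1 mem_enum.
have R01 r : r \in R0 -> word_eval r = 1%g by rewrite R0P => /andP[_ /eqP].
pose P := Presentation R01; exists P; split=> // c cyc.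
have [a ->] := zP c cyc.
have /choice[b bP] : forall i, exists b, @boundary2 (cayley_complex P) b = z i.
  move=> i; have [|||b bz _] := @fillable_cycle (cayley_complex P) N 1 _ (z i).
  - move=> u p /edge_path_cayley[w [pw sw uw]] pN.
    have wR : w \in R0.
      by rewrite R0P sw pN; apply/eqP/(mulgI u); rewrite -uw mulg1.
    exists << (u, [` wR]%fset) >>; last by rewrite norm1U.
    by rewrite boundary2U pw.
  - exact: zcyc.
  - exact: (leq_bigmax i).
  by exists b.
exists (\sum_i chain_act (a i) (b i)); rewrite raddf_sum /=; apply: eq_bigr => i _.
by rewrite boundary2_act bP.
Qed.

(** * The equivalence *)

Lemma fun_preceq_nat (R : realType) (f g : nat -> \bar R) (F G : nat -> nat)
    (M K N : nat) :
  (forall n, f n = ((F n)%:R)%:E) -> (forall n, g n = ((G n)%:R)%:E) ->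
  {homo G : m n / (m <= n)%N} ->
  (forall n, (F n <= M * G (K * n) + N * n)%N) ->
  fun_preceq (step_extend f) (step_extend g).
Proof.
move=> fF gG Gmono le.
(* The first two constants must be positive, whence the successors. *)
exists (M.+1)%:R, (K.+1)%:R, 0, N%:R, 0.
split=> [|x x0]; first by rewrite !ltr0Sn !ler0n lexx.
rewrite /step_extend fF gG !addr0; set n := Num.truncn x.
have nx : n%:R <= x by rewrite truncn_le.
rewrite -EFinM -EFinD lee_fin.
have Kn : (K * n <= Num.truncn ((K.+1)%:R * x))%N.
  rewrite truncn_ge_nat ?mulr_ge0 ?ler0n // natrM ler_pM ?ler0n //.
  by rewrite ler_nat.
apply: (@le_trans _ _ ((M * G (K * n) + N * n)%N%:R)); first by rewrite ler_nat.
rewrite natrD !natrM lerD ?ler_pM ?ler0n ?ler_nat //.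
exact: Gmono.
Qed.

Theorem proposition2p26 (R : realType) (H : groupType) :
  type_FP2 H ->
  exists h : nat -> R,
    [/\ forall n, 0 <= h n,
        superadditive h,
        exists P : presentation H, homological_finite_presentation P &
        forall P : presentation H, homological_finite_presentation P ->
          fun_equiv (step_extend (FA R (cayley_complex P)))
                    (step_extend (fun n => (h n)%:E))].
Proof.
move=> /FP2_presentation exP.
have FA_values (P : presentation H) : homological_finite_presentation P ->
    exists F : nat -> nat, forall n, is_FA (cayley_complex P) n (F n).
  move=> [_ H1P]; have /choice[F FP] : forall n, exists k, is_FA (cayley_complex P) n k.
    by move=> n; have [M /ex_is_FA] := cayley_cycle_fillable n H1P.
  by exists F.
have mono X F : (forall n, is_FA X n (F n)) -> {homo F : m n / (m <= n)%N}.
  by move=> FP m n; apply: is_FA_le (FP m) (FP n).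
have [[s sP]|inf] := pselect (exists s : seq H, forall g, g \in s).
  exists (fun=> 0); split=> // P hP.
  have [F FP] := FA_values P hP; have [C CP] := FA_finite_group sP hP.
  have FAE n := @FA_is_FA R _ n _ (FP n).
  split.
    apply: (fun_preceq_nat (K := 0) FAE (fun=> erefl)
             (G := fun=> 0%N) (M := 0) (N := C)) => // n.
    by rewrite mul0n; apply: CP (FP n).
  apply: (fun_preceq_nat (fun=> erefl) FAE (F := fun=> 0%N)
           (M := 0) (K := 0) (N := 0)) => //.
  exact: mono FP.
have infH (s : seq H) : exists g, g \notin s.
  apply: contrapT => no; apply: inf; exists s => g.
  by apply: contrapT => /negP gs; apply: no; exists g.
have [P hP] := exP; have [F FP] := FA_values P hP.
exists (fun n => (F n)%:R); split=> // [m n|Q hQ].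
  by rewrite -natrD ler_nat; apply: FA_superadditive infH (FP m) (FP n) (FP _).
have [G GQ] := FA_values Q hQ.
have FAE n := @FA_is_FA R _ n _ (GQ n).
have [K [M [N le]]] := FA_comparison hP hQ.
have [K' [M' [N' le']]] := FA_comparison hQ hP.
split.
  apply: (fun_preceq_nat FAE (fun=> erefl) (mono _ _ FP)) => n.
  exact: le (FP _) (GQ n).
apply: (fun_preceq_nat (fun=> erefl) FAE (mono _ _ GQ)) => n.
exact: le' (GQ _) (FP n).
Qed.
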